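(* Let $X$ be a countable regular $T_1$ space without isolated points whose topology is analytic. Then $X$ is $SS^+$ if, and only if, $X$ has an $F_\sigma$ weak $\pi$-base, i.e. a weak $\pi$-base which is an $F_\sigma$ subset of $2^X$.
   Context: $2^X$ is the power set of the countable set $X$, identified via characteristic functions with the product of copies of the discrete space $\{0,1\}$, with the product topology. The topology $\tau$ of $X$ is analytic if $\tau$ is an analytic subset of $2^X$ (a continuous image of a Polish space). The game $G_{fin}$ on $X$: in round $n\in\mathbb N$, player I picks a dense subset $D_n$ of $X$ and then player II picks a finite set $a_n\subseteq D_n$. Player II wins the run if $\bigcup_n a_n$ is dense in $X$; otherwise player I wins. $X$ is $SS^+$ if player II has a winning strategy for $G_{fin}$. A collection $\mathcal P$ of (not necessarily open) subsets of $X$ is a weak $\pi$-base if every set in $\mathcal P$ has non-empty interior and for every non-empty open set $W$ there is $V\in\mathcal P$ with $V\subseteq W$. *)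

(* Defs.v *)
(* MathComp-Analysis *)
From HB Require Import structures.
From mathcomp Require Import all_boot all_order all_algebra.
From mathcomp Require Import all_classical all_reals all_analysis borel_hierarchy.

Set Implicit Arguments.
Unset Strict Implicit.
Unset Printing Implicit Defensive.

Local Open Scope classical_set_scope.

(* [bool] carries the discrete topology and [{ptws X -> bool}] the product
   topology. *)
Definition charfun (X : Type) (A : set X) : {ptws X -> bool} :=
  fun x => `[< A x >].

(* A family of subsets of X, seen as a subset of 2^X. *)
Definition in2X (X : Type) (F : set (set X)) : set {ptws X -> bool} :=
  [set charfun A | A in F].

Definition separable_space (T : topologicalType) : Prop :=
  exists2 D : set T, countable D & dense D.

Definition complete_metric (R : realType) (M : metricType R) : Prop :=
  forall u : nat -> M, cauchy (u @ \oo) -> exists l : M, u @ \oo --> l.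

(* The Polish spaces are the spaces underlying the complete separable metric
   spaces; a [metricType] may be empty, so the empty set is analytic. *)
Definition analytic (R : realType) (Y : topologicalType) (A : set Y) : Prop :=
  exists (M : metricType R) (f : M -> Y),
    [/\ complete_metric M, separable_space M, continuous f & A = range f].

Definition analytic_topology (R : realType) (X : topologicalType) : Prop :=
  analytic R (in2X [set U : set X | open U]).

(* A strategy of player II maps the finite sequence D_0, ..., D_n of the moves
   of player I so far to the answer a_n; the earlier answers of player II are
   determined by the strategy and these moves. *)
Definition Gfin_answers (X : Type) (s : seq (set X) -> set X)
    (D : nat -> set X) (n : nat) : set X :=
  s (mkseq D n.+1).

Definition Gfin_winning_II (X : topologicalType)
    (s : seq (set X) -> set X) : Prop :=
  forall D : nat -> set X, (forall n, dense (D n)) ->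
    (forall n, finite_set (Gfin_answers s D n) /\
               Gfin_answers s D n `<=` D n) /\
    dense (\bigcup_n Gfin_answers s D n).

Definition SSplus (X : topologicalType) : Prop :=
  exists s : seq (set X) -> set X, Gfin_winning_II s.

Definition weak_pi_base (X : topologicalType) (P : set (set X)) : Prop :=
  (forall V, P V -> interior V !=set0) /\
  (forall W : set X, open W -> W !=set0 -> exists2 V, P V & V `<=` W).

(* Main.v *)
Require Import Defs.
From HB Require Import structures.
From mathcomp Require Import all_boot all_order all_algebra.
From mathcomp Require Import all_classical all_reals all_analysis borel_hierarchy.

Set Implicit Arguments.
Unset Strict Implicit.

Local Open Scope classical_set_scope.

(** If a weak π-base is a union of closed, hence compact, sets [F i] of [2^X],
    then at round [n] a finite subset of [D_n] meets every member of
    [F 0], ..., [F n], since every member has non-empty interior and so meets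
    the dense set [D_n]; such answers win for player II.

    Conversely, let [s] win for player II.  At a position [p], let [K p] be the
    family of the sets that meet every possible next answer [s (p, D)].  It is
    closed in [2^X], because the answers are finite, and each of its members
    meets every dense set, hence has non-empty interior.  As [X] has countably
    many finite subsets, a countable tree of positions realizes, at each of its
    nodes, all the possible next answers.  A non-empty open set outside [K p]
    for every [p] in the tree would be missed by all the answers along some
    branch, so the families [K p] form together an F_σ weak π-base. *)

Lemma in2XE (X : Type) (F : set (set X)) :
  in2X F = [set g | F [set x | g x]].
Proof.
apply/seteqP; split=> [_ [A FA <-]|g Fg] /=.
  suff -> : [set x | charfun A x] = A by [].
  by apply/seteqP; split=> x /= /asboolP.
exists [set x | g x] => //; apply/funext => x.
by rewrite /charfun /= asboolb.
Qed.

Lemma clopen_evaluation (X : topologicalType) (x : X) :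
  clopen [set g : {ptws X -> bool} | g x].
Proof.
have ev : continuous (fun g : {ptws X -> bool} => g x) by exact: proj_continuous.
split.
- by apply: (open_comp (D := [set b : bool | b])) => // *; exact: discrete_open.
- by apply: (closed_comp (D := [set b : bool | b])) => // *; exact: discrete_closed.
Qed.

Lemma closed_compact_2X (X : topologicalType) (F : set {ptws X -> bool}) :
  closed F -> compact F.
Proof.
move=> clF; apply: (subclosed_compact clF) (@subsetT _ F).
have := @tychonoff X (fun=> bool) (fun=> setT) (fun=> bool_compact).
by congr compact; apply/seteqP; split.
Qed.

(** The open sets [[set g | g x]] with [x] in [D] cover [F]. Compactness bounds the codes [f x] that
    are needed, and [f] is injective. *)
Lemma compact_finite_transversal (X : topologicalType)
    (F : set {ptws X -> bool}) (D : set X) :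
  countable [set: X] -> compact F ->
  (forall g, F g -> exists2 x, D x & g x) ->
  exists a : set X, [/\ finite_set a, a `<=` D &
    forall g, F g -> exists2 x, a x & g x].
Proof.
move=> /countable_injP[f f_inj] /compact_near_coveringP cF FD.
have [x Fx|N _ hN] := cF nat \oo
    (fun n (g : {ptws X -> bool}) => exists x, [/\ D x, (f x < n)%N & g x]) _.
  have [y Dy xy] := FD x Fx.
  exists ([set g : {ptws X -> bool} | g y], [set n | (f y < n)%N]).
    split; last by exists (f y).+1.
    by apply: open_nbhs_nbhs; split=> //; have [] := clopen_evaluation y.
  by move=> [g n] [/= gy fyn]; exists y.
exists (D `&` f @^-1` `I_N); split => [||g Fg].
- apply: finite_setIr; apply: finite_preimage; last exact: finite_II.
  by move=> x y _ _; apply: f_inj; rewrite inE.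
- exact: subIsetl.
- by have [x [Dx fx gx]] := hN N (leqnn N) g Fg; exists x.
Qed.

Lemma Fsigma_weak_pi_base_SSplus (X : topologicalType) (P : set (set X)) :
  countable [set: X] -> weak_pi_base P -> Fsigma (in2X P) -> SSplus X.
Proof.
move=> cX [Pint Psub] [F clF PF].
pose U n := \bigcup_(i in `I_n) F i.
have cU n : compact (U n).
  by apply: closed_compact_2X; apply: closed_bigcup => //; exact: finite_II.
have UP n g : U n g -> P [set x | g x].
  move=> [i _ Fig].
  have : in2X P g by rewrite PF; exists i.
  by rewrite in2XE.
have /choice[t tP] (nD : nat * set X) : exists a : set X, dense nD.2 ->
    [/\ finite_set a, a `<=` nD.2 & forall g, U nD.1 g -> exists2 x, a x & g x].
  have [dD|ndD] := pselect (dense nD.2); last by exists set0.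
  have [g Ug|a aP] := @compact_finite_transversal X _ nD.2 cX (cU nD.1).
    have [x [gx Dx]] := dD _ (Pint _ (UP _ _ Ug)) (open_interior _).
    by exists x => //; exact: (interior_subset gx).
  by exists a.
(* At round [n] the position has size [n.+1], so the answer meets every member of [F 0], ...,
   [F n]. *)
exists (fun p => t (size p, last setT p)) => D dD.
have ansE n : Gfin_answers (fun p => t (size p, last setT p)) D n = t (n.+1, D n).
  by rewrite /Gfin_answers size_mkseq mkseqS last_rcons.
split=> [n|W W0 oW]; first by rewrite ansE; have [] := tP (n.+1, D n) (dD n).
have [V PV VW] := Psub W oW W0.
have : in2X P (charfun V) by exists V.
rewrite PF => -[i _ Fi].
have [_ _ ti] := tP (i.+1, D i) (dD i).
have [|x tx /asboolP Vx] := ti (charfun V); first by exists i => /=.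
by exists x; split; [exact: VW | exists i => //; rewrite ansE].
Qed.

Definition meeting_next_answers (X : topologicalType)
    (s : seq (set X) -> set X) (p : seq (set X)) : set (set X) :=
  [set V | forall D, dense D -> V `&` s (rcons p D) !=set0].

Lemma closed_meeting_next_answers (X : topologicalType)
    (s : seq (set X) -> set X) (p : seq (set X)) :
  (forall D, dense D -> finite_set (s (rcons p D))) ->
  closed (in2X (meeting_next_answers s p)).
Proof.
move=> fin.
have -> : in2X (meeting_next_answers s p) =
    \bigcap_(D in [set D : set X | dense D]) \bigcup_(x in s (rcons p D))
      [set g : {ptws X -> bool} | g x].
  rewrite in2XE; apply/seteqP; split=> g gP D /gP.
    by case=> x [gx sx]; exists x.
  by case=> x sx gx; exists x.
apply: closed_bigI => D dD; apply: closed_bigcup => [|x _]; first exact: fin.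
by have [] := clopen_evaluation x.
Qed.

Lemma meeting_next_answers_interior (X : topologicalType)
    (s : seq (set X) -> set X) (p : seq (set X)) (V : set X) :
  (forall D, dense D -> s (rcons p D) `<=` D) ->
  meeting_next_answers s p V -> V^° !=set0.
Proof.
move=> sub KV; apply: contrapT => /nonemptyPn V0.
(* Player I can play the complement of [V]: the answer stays inside it and misses [V]. *)
have dV : dense (~` V).
  move=> O [x Ox] oO; apply: contrapT => OV.
  suff : V^° x by rewrite V0.
  apply: (filterS _ (open_nbhs_nbhs (conj oO Ox))) => y Oy.
  apply: contrapT => nVy.
  by apply: OV; exists y.
by have [x [Vx /(sub _ dV)]] := KV _ dV.
Qed.

Lemma denseT (X : topologicalType) : dense [set: X].
Proof. by move=> O O0 _; rewrite setIT. Qed.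

(** The default [setT] is dense, so this constrains only the entries of [p] and makes [nth setT p] a
    full run, to which [win] applies. *)
Definition legal_position (X : topologicalType) (p : seq (set X)) : Prop :=
  forall n, dense (nth setT p n).

Lemma legal_position_rcons (X : topologicalType) (p : seq (set X)) (D : set X) :
  legal_position p -> dense D -> legal_position (rcons p D).
Proof.
move=> lp dD n; rewrite nth_rcons.
by case: ltnP => [_|_]; [exact: lp | case: eqP => // _; exact: denseT].
Qed.

Lemma winning_next_answer (X : topologicalType) (s : seq (set X) -> set X)
    (p : seq (set X)) (D : set X) :
  Gfin_winning_II s -> legal_position p -> dense D ->
  finite_set (s (rcons p D)) /\ s (rcons p D) `<=` D.
Proof.
move=> win lp dD.
have [/(_ (size p)) + _] := win _ (legal_position_rcons lp dD).
by rewrite /Gfin_answers -(size_rcons p D) mkseq_nth nth_rcons ltnn eqxx.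
Qed.

(* A node of the tree lists, in reverse order, codes of the answers of player
   II, and [c p l] is a move of player I at [p] answered by the set coded by
   [l]. *)
Fixpoint position (X : Type) (c : seq (set X) -> seq nat -> set X)
    (t : seq (seq nat)) : seq (set X) :=
  if t is l :: t' then rcons (position c t') (c (position c t') l) else [::].

Lemma SSplus_Fsigma_weak_pi_base (X : topologicalType) :
  countable [set: X] -> SSplus X ->
  exists P : set (set X), weak_pi_base P /\ Fsigma (in2X P).
Proof.
move=> /countable_injP[f f_inj] [s win].
pose decode (l : seq nat) := [set x : X | f x \in l].
have decode_surj (a : set X) : finite_set a -> exists l, a = decode l.
  move=> /(finite_image f)/finite_seqP[l fal]; exists l.
  apply/seteqP; split=> x.
    move=> ax; have : (f @` a) (f x) by exists x.
    by rewrite fal.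
  move=> fx; have : (f @` a) (f x) by rewrite fal.
  by move=> [y ay /f_inj <-] //; rewrite inE.
(* One dense move is chosen for each answer that can occur; for the other codes [setT] is a
   placeholder. *)
have /choice[c' c'P] (pl : seq (set X) * seq nat) : exists D : set X, dense D /\
    forall E, dense E -> s (rcons pl.1 E) = decode pl.2 ->
      s (rcons pl.1 D) = decode pl.2.
  have [[D [dD sD]]|none] :=
    pselect (exists D, dense D /\ s (rcons pl.1 D) = decode pl.2).
    by exists D.
  exists setT; split; first exact: denseT.
  by move=> E dE sE; case: none; exists E.
pose c p l := c' (p, l).
have legal t : legal_position (position c t).
  elim: t => [n|l t IH] /=; first by rewrite nth_nil; exact: denseT.
  by apply: legal_position_rcons => //; have [] := c'P (position c t, l).
pose K t := meeting_next_answers s (position c t).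
pose F n := if unpickle n is Some t then in2X (K t) else set0.
exists (\bigcup_t K t); split; last first.
  exists F => [n|].
    rewrite /F; case: unpickle => [t|]; last exact: closed0.
    by apply: closed_meeting_next_answers => D /(winning_next_answer win (legal t))[].
  rewrite in2XE; apply/seteqP; split=> [g [t _ Ktg]|g [n _]].
    by exists (pickle t) => //; rewrite /F pickleK in2XE.
  by rewrite /F; case: unpickle => // t; rewrite in2XE => Ktg; exists t.
split=> [V [t _]|W oW W0].
  apply: meeting_next_answers_interior => D.
  by move=> /(winning_next_answer win (legal t))[].
apply: contrapT => noK.
(* Since [W] is outside [K t], some dense move has an answer missing [W]; the move chosen for the
   code of that answer has the same answer. *)
have /choice[g gP] t : exists l,
    W `&` s (rcons (position c t) (c (position c t) l)) = set0.
  have : ~ K t W by move=> KW; apply: noK; exists W => //; exists t.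
  move=> /existsNP[D /not_implyP[dD /nonemptyPn WD]].
  have [/decode_surj[l sl] _] := winning_next_answer win (legal t) dD.
  exists l; have [_ /(_ D dD sl)] := c'P (position c t, l).
  by rewrite -/(c _ _) /= => ->; rewrite -sl.
(* Following [g] from the root gives a legal run all of whose answers miss [W]. *)
pose fix branch n := if n is n'.+1 then g (branch n') :: branch n' else [::].
pose D n := c (position c (branch n)) (g (branch n)).
have branchE n : mkseq D n = position c (branch n).
  by elim: n => [//|n IH]; rewrite mkseqS IH.
have [n|_ /(_ W W0 oW)[x [Wx [n _]]]] := win D.
  by have [] := c'P (position c (branch n), g (branch n)).
rewrite /Gfin_answers branchE => sx.
suff : set0 x by [].
by rewrite -(gP (branch n)).
Qed.

Theorem corollary4p5 (R : realType) (X : topologicalType)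
    (X_countable : countable [set: X])
    (X_regular : @regular_space X)
    (X_T1 : @accessible_space X)
    (X_no_isolated : isolated [set: X] = set0)
    (X_analytic : analytic_topology R X) :
  SSplus X <->
  exists P : set (set X), weak_pi_base P /\ Fsigma (in2X P).
Proof.
split; first exact: SSplus_Fsigma_weak_pi_base.
by move=> [P [wP FP]]; exact: Fsigma_weak_pi_base_SSplus wP FP.
Qed.
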